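(* Let $\mathcal T'\in\mathbb R^{n^{\times d}}_{ps,+}$ be an irreducible tensor with positive diagonal entries $t'_{i,\dots,i}>0$, $i\in[n]$. Let $u,w\in\mathbb R^n$ be two given positive vectors satisfying $\sum_{i=1}^n u_iw_i=1$. Then there exists a tensor $\mathcal T\in\mathbb R^{n^{\times d}}_{ps,+}$ diagonally equivalent to $\mathcal T'$ such that $\mathcal T(u)=u^{\circ(d-1)}$, $\rho(\mathcal T)=1$, and, with $A=\operatorname{diag}(u)^{-(d-2)}D\mathcal T(u)$, $$Au=(d-1)u,\qquad A^\top w=(d-1)w,\qquad w^\top u=1.$$
   Context: Let $n\ge1$, $d\ge3$ be integers, $[n]=\{1,\dots,n\}$. $\mathbb R^{n^{\times d}}_{ps,+}$ is the set of tensors $\mathcal T=[t_{i_1,\dots,i_d}]$, $i_1,\dots,i_d\in[n]$, with nonnegative real entries symmetric in the last $d-1$ indices. For $x\in\mathbb C^n$, $\mathcal T(x)_i=\sum_{i_2,\dots,i_d\in[n]}t_{i,i_2,\dots,i_d}x_{i_2}\cdots x_{i_d}$, and $x^{\circ p}=(x_1^p,\dots,x_n^p)^\top$. An eigenvalue of $\mathcal T$ is $\lambda\in\mathbb C$ with $\mathcal T(x)=\lambda x^{\circ(d-1)}$ for some nonzero $x\in\mathbb C^n$; $\rho(\mathcal T)$ is the maximum modulus of the eigenvalues. $D\mathcal T(u)\in\mathbb R^{n\times n}$ has entries $D\mathcal T(u)_{ij}=(d-1)\sum_{i_3,\dots,i_d}t_{i,j,i_3,\dots,i_d}u_{i_3}\cdots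 u_{i_d}$. $\mathcal T$ is irreducible if for each nonempty proper subset $I\subsetneq[n]$ there exist $i\in I$ and $j_1,\dots,j_{d-1}\in[n]\setminus I$ with $t_{i,j_1,\dots,j_{d-1}}>0$. Tensors $\mathcal T=[t_{i_1,\dots,i_d}]$ and $\mathcal T'=[t'_{i_1,\dots,i_d}]$ in $\mathbb R^{n^{\times d}}_{ps,+}$ are diagonally equivalent if there are $b,c\in\mathbb R^n$ with $t'_{i_1,\dots,i_d}=t_{i_1,\dots,i_d}\,e^{b_{i_1}+\sum_{j=2}^d c_{i_j}}$ for all $i_1,\dots,i_d\in[n]$. *)

(* Defs.v *)
From HB Require Import structures.
From mathcomp Require Import all_boot all_order all_algebra.
From mathcomp Require Import complex.
From mathcomp Require Import reals sequences exp.

Set Implicit Arguments.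
Unset Strict Implicit.
Unset Printing Implicit Defensive.

Import Order.TTheory GRing.Theory Num.Theory.
Local Open Scope ring_scope.
Local Open Scope complex_scope.

Definition tensor (R : Type) (n d : nat) := {ffun d.-tuple 'I_n -> R}.

(* Multi-indices are given as sequences so that [i :: J] and [i :: j :: K] can
   be used without casts; the value 0 is only reached when [size s != d]. *)
Definition entry (R : nmodType) (n d : nat) (T : tensor R n d)
    (s : seq 'I_n) : R :=
  oapp (fun I : d.-tuple 'I_n => T I) 0 (insub s).

Lemma entryE (R : nmodType) (n d : nat) (T : tensor R n d)
    (I : d.-tuple 'I_n) : entry T I = T I.
Proof. by rewrite /entry valK. Qed.

Definition tensor_map (R S : Type) (n d : nat) (f : R -> S) (T : tensor R n d) :
    tensor S n d :=
  [ffun I => f (T I)].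

Definition tensor_app (R : comNzRingType) (n d : nat) (T : tensor R n d)
    (x : 'cV[R]_n) : 'cV[R]_n :=
  \col_i \sum_(J : d.-1.-tuple 'I_n) entry T (i :: J) * \prod_(j <- J) x j 0.

Definition vec_pow (R : comNzRingType) (n : nat) (x : 'cV[R]_n) (p : nat) :
    'cV[R]_n :=
  map_mx (fun a => a ^+ p) x.

Definition tensor_D (R : comNzRingType) (n d : nat) (T : tensor R n d)
    (u : 'cV[R]_n) : 'M[R]_n :=
  \matrix_(i, j) (d.-1%:R * \sum_(K : d.-2.-tuple 'I_n)
                              entry T (i :: j :: K) * \prod_(k <- K) u k 0).

Definition ps_nonneg (R : numDomainType) (n d : nat) (T : tensor R n d) : Prop :=
  (forall I : d.-tuple 'I_n, 0 <= T I) /\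
  (forall (i : 'I_n) (J K : d.-1.-tuple 'I_n),
      perm_eq J K -> entry T (i :: J) = entry T (i :: K)).

Definition tensor_irreducible (R : numDomainType) (n d : nat)
    (T : tensor R n d) : Prop :=
  forall I : {set 'I_n}, I != set0 -> I \proper [set: 'I_n] ->
  exists (i : 'I_n) (J : d.-1.-tuple 'I_n),
    [/\ i \in I, forall j : 'I_n, j \in J -> j \notin I & 0 < entry T (i :: J)].

Definition diag_equivalent (R : realType) (n d : nat) (T T' : tensor R n d) :
    Prop :=
  exists b c : 'cV[R]_n, forall (i : 'I_n) (J : d.-1.-tuple 'I_n),
    entry T' (i :: J) =
      entry T (i :: J) * expR (b i 0 + \sum_(j <- J) c j 0).

Definition tensor_eigenvalue (R : rcfType) (n d : nat) (T : tensor R n d)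
    (lambda : R[i]) : Prop :=
  exists x : 'cV[R[i]]_n,
    x != 0 /\
    tensor_app (tensor_map (real_complex R) T) x = lambda *: vec_pow x d.-1.

(* The norm of [R[i]] takes its values in [R[i]], hence the cast [rho%:C]. *)
Definition is_spectral_radius (R : rcfType) (n d : nat) (T : tensor R n d)
    (rho : R) : Prop :=
  (exists lambda : R[i], tensor_eigenvalue T lambda /\ `|lambda| = rho%:C) /\
  (forall lambda : R[i], tensor_eigenvalue T lambda -> `|lambda| <= rho%:C).

(* Main.v *)
(* Put [p i = u i * w i] and [M i J = T'(i, J) u^J w i / u i ^ (d - 2)].  The
   scaling [c] is a minimiser of
     G(c) = sum_i p i ln (sum_J M i J exp (sum_(j in J) (c j - c i))),
   which is invariant under translation of [c].  The diagonal entries bound each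
   logarithm from below, so a sublevel set of [G] bounds every sum of
   [c j - c i], [j] in [J], with [M i J > 0]; irreducibility turns this into a
   bound on the spread of [c], and a minimiser exists.  At a minimum, after
   normalising the rows, the scaled [M] has row sums [p i], and weighting each
   [J] by its number of occurrences of [l] gives [(d - 1) p l]: these two
   identities are [T(u) = u^(d-1)] and the left eigenvector equation for [w]. *)

Require Import Defs.
From HB Require Import structures.
From mathcomp Require Import all_boot all_order all_algebra.
From mathcomp Require Import perm complex.
From mathcomp Require Import reals sequences exp.
From mathcomp Require Import classical_sets topology normedtype derive.
From mathcomp Require Import ring lra.

Set Implicit Arguments.
Unset Strict Implicit.
Unset Printing Implicit Defensive.

Import Order.TTheory GRing.Theory Num.Theory.
Import numFieldNormedType.Exports.
Local Open Scope ring_scope.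
Local Open Scope complex_scope.

(** * Spread of a scaling under irreducibility *)

(** The sets of indices [l] with [c l - c j <= s K] grow from [j]: irreducibility gives [i0] inside
    and [J] outside with [M i0 J > 0], and some term of the sum over [J] is at most [K], so the next
    set is strictly larger until it is everything. *)
Lemma irreducible_spread (R : realFieldType) (n m : nat)
    (M : 'I_n -> m.-tuple 'I_n -> R) (c : 'I_n -> R) (K : R) :
  (0 < m)%N -> 0 <= K ->
  (forall I : {set 'I_n}, I != finset.set0 -> I \proper [set: 'I_n]%SET ->
    exists (i : 'I_n) (J : m.-tuple 'I_n),
      [/\ i \in I, forall j : 'I_n, j \in J -> j \notin I & 0 < M i J]) ->
  (forall i J, 0 < M i J -> \sum_(j <- J) (c j - c i) <= K) ->
  forall i j, c i - c j <= n%:R * K.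
Proof.
move=> m0 K0 irr hK i j.
pose I s := [set l | c l - c j <= s%:R * K]%SET.
suff H : forall s, (s < #|I s|)%N || (I s == [set: 'I_n]%SET).
  case/orP: (H n) => [|/eqP In].
    by rewrite ltnNge (leq_trans (max_card _)) // card_ord.
  have : i \in I n by rewrite In finset.in_setT.
  by rewrite inE.
have jI s : j \in I s by rewrite inE subrr mulr_ge0.
elim=> [|s /orP[IHs|/eqP IHs]].
- by apply/orP; left; apply/card_gt0P; exists j.
- have [->|IT] := eqVneq (I s.+1) [set: 'I_n]%SET; first by rewrite orbT.
  rewrite orbF.
  have sub : I s \subset I s.+1.
    apply/fintype.subsetP => l; rewrite !inE => /le_trans; apply.
    by rewrite ler_wpM2r // ler_nat.
  have pr : I s \proper [set: 'I_n]%SET.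
    rewrite properT; apply: contraNneq IT => IT.
    by rewrite -finset.subTset -IT.
  have n0 : I s != finset.set0 by apply/finset.set0Pn; exists j.
  have [i0 [J [i0I JI MJ]]] := irr _ n0 pr.
  suff [l lJ lK] : exists2 l, l \in J & c l - c i0 <= K.
    apply: leq_ltn_trans IHs _; apply: proper_card.
    rewrite properE sub; apply/subsetPn; exists l; last exact: JI.
    move: i0I; rewrite !inE -natr1 => i0I; lra.
  (* If every term exceeded [K >= 0], so would the sum, which is nonempty because [0 < m]. *)
  apply/exists_inP; apply: contraT; rewrite negb_exists_in => /forall_inP H.
  have pos l : l \in tval J -> K < c l - c i0 by move/H; rewrite -ltNge.
  have := hK _ _ MJ; rewrite leNgt => /negP[].
  case: (tval J) (size_tuple J) pos => [/= sJ|x r _ pos].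
    by rewrite -sJ in m0.
  rewrite big_cons -[K]addr0; apply: ltr_leD.
    by apply: pos; rewrite inE eqxx.
  rewrite big_seq sumr_ge0 // => l lr; apply: le_trans K0 (ltW (pos _ _)).
  by rewrite inE lr orbT.
- apply/orP; right; rewrite -finset.subTset -IHs; apply/fintype.subsetP => l.
  by rewrite !inE => /le_trans; apply; rewrite ler_wpM2r // ler_nat.
Qed.

(** * First-order condition for exponential sums *)

(** From [1 - x <= expR (- x)] follows [(1 - x) expR x <= 1], while [(1 - x) (1 + x + 2 x^2) = 1 +
    x^2 (1 - 2 x)] is at least 1. *)
Lemma expR_le_quadratic (R : realType) (x : R) :
  `|x| <= 2^-1 -> expR x <= 1 + x + 2 * x ^+ 2.
Proof.
rewrite ler_norml => /andP[x1 x2].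
have h : 1 - x <= expR (- x) by exact: expR_ge1Dx.
have e0 := expR_gt0 x.
have E : expR (- x) * expR x = 1 by rewrite expRN mulVf ?gt_eqF.
have : (1 - x) * expR x <= 1 by rewrite -[leRHS]E ler_wpM2r // ltW.
have : 1 <= (1 - x) * (1 + x + 2 * x ^+ 2).
  have : 0 <= x ^+ 2 * (1 - 2 * x) by rewrite mulr_ge0 ?sqr_ge0 //; lra.
  nra.
move=> a b; have : (1 - x) * expR x <= (1 - x) * (1 + x + 2 * x ^+ 2).
  exact: le_trans b a.
by rewrite ler_pM2l //; lra.
Qed.

(** The sum, as a function of [t], is minimal at 0, so its derivative [D] there vanishes; the
    quadratic bound replaces differentiation. *)
Lemma expR_sum_stationary (R : realType) (X : finType) (N k : X -> R) :
  (forall x, 0 <= N x) ->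
  (forall t, 0 <= \sum_x N x * (expR (t * k x) - 1)) ->
  \sum_x N x * k x = 0.
Proof.
move=> N0 H.
pose A := 1 + \sum_x `|k x|; pose D := \sum_x N x * k x.
pose C := \sum_x N x * (2 * k x ^+ 2).
have A0 : 0 < A by rewrite ltr_pwDl // sumr_ge0.
have kA x : `|k x| <= A.
  rewrite /A (bigD1 x) //= addrCA lerDl addr_ge0 // sumr_ge0 //.
have C0 : 0 <= C.
  by rewrite sumr_ge0 // => x _; rewrite mulr_ge0 // mulr_ge0 // sqr_ge0.
have key t : `|t| <= (2 * A)^-1 -> 0 <= t * D + t ^+ 2 * C.
  move=> tA; apply: le_trans (H t) _.
  rewrite /D /C !mulr_sumr -big_split /=; apply: ler_sum => x _.
  have : `|t * k x| <= 2^-1.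
    rewrite normrM (le_trans (ler_pM _ _ tA (kA x))) //.
    by rewrite invfM -mulrA mulVf ?mulr1 // gt_eqF.
  move/expR_le_quadratic => h.
  have -> : t * (N x * k x) + t ^+ 2 * (N x * (2 * k x ^+ 2))
    = N x * (t * k x + 2 * (t * k x) ^+ 2) by ring.
  by rewrite ler_wpM2l //; lra.
apply/eqP; apply: contraT => D0.
pose e := (2 * A)^-1; have e0 : 0 < e by rewrite invr_gt0 mulr_gt0.
(* The first bound keeps [key] applicable; the second forces [s C < |D|], so a step of size [s]
   against the sign of [D] makes [t D + t^2 C] negative. *)
pose s := Num.min e (`|D| / (2 * (C + 1))).
have C1 : 0 < 2 * (C + 1) by rewrite mulr_gt0 // ltr_wpDl.
have s0 : 0 < s by rewrite lt_min e0 divr_gt0 // normr_gt0.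
have se : s <= e by rewrite ge_min lexx.
have sD : s * (2 * (C + 1)) <= `|D|.
  by rewrite -ler_pdivlMr // ge_min lexx orbT.
have := key (- s * Num.sg D).
rewrite !normrM normrN (gtr0_norm s0) normr_sg D0 mulr1 => /(_ se).
rewrite -mulrA -normrEsg -/D exprMn sqrrN sqr_sg D0 mulr1 => h.
have : 0 <= s * (s * C - `|D|) by move: h; lra.
rewrite pmulr_rge0 // => h'.
nra.
Qed.

(** * The potential and its minimiser *)

Definition rel_weight (R : realType) (n : nat) (c : 'I_n -> R) (i : 'I_n)
    (J : seq 'I_n) : R :=
  expR (\sum_(j <- J) (c j - c i)).

Definition row_weight (R : realType) (n m : nat)
    (M : 'I_n -> m.-tuple 'I_n -> R) (c : 'I_n -> R) (i : 'I_n) : R :=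
  \sum_(J : m.-tuple 'I_n) M i J * rel_weight c i J.

Definition log_potential (R : realType) (n m : nat) (p : 'I_n -> R)
    (M : 'I_n -> m.-tuple 'I_n -> R) (c : 'I_n -> R) : R :=
  \sum_(i < n) p i * ln (row_weight M c i).

Lemma ler_row_weight (R : realType) (n m : nat)
    (M : 'I_n -> m.-tuple 'I_n -> R) (c : 'I_n -> R) i J :
  (forall i J, 0 <= M i J) -> M i J * rel_weight c i J <= row_weight M c i.
Proof.
move=> M0; rewrite /row_weight (bigD1 J) //= lerDl sumr_ge0 // => L _.
by rewrite mulr_ge0 // expR_ge0.
Qed.

Lemma rel_weight_nseq (R : realType) (n m : nat) (c : 'I_n -> R) i :
  rel_weight c i (nseq m i) = 1.
Proof.
rewrite /rel_weight big1_seq ?expR0 // => j /andP[_].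
by rewrite mem_nseq => /andP[_ /eqP->]; rewrite subrr.
Qed.

Lemma ler_diag_row_weight (R : realType) (n m : nat)
    (M : 'I_n -> m.-tuple 'I_n -> R) (c : 'I_n -> R) i :
  (forall i J, 0 <= M i J) -> M i [tuple of nseq m i] <= row_weight M c i.
Proof.
move=> M0; apply: le_trans (ler_row_weight c i [tuple of nseq m i] M0).
by rewrite rel_weight_nseq mulr1.
Qed.

Lemma log_potential_shift (R : realType) (n m : nat) (p : 'I_n -> R)
    (M : 'I_n -> m.-tuple 'I_n -> R) (c : 'I_n -> R) (t : R) :
  log_potential p M (fun i => c i - t) = log_potential p M c.
Proof.
apply: eq_bigr => i _; congr (_ * ln _); apply: eq_bigr => J _.
congr (_ * expR _); apply: eq_bigr => j _; ring.
Qed.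

(** Row vectors carry the topology used for compactness; the positive diagonal entries keep every
    argument of [ln] positive. *)
Lemma continuous_log_potential (R : realType) (n m : nat) (p : 'I_n -> R)
    (M : 'I_n -> m.-tuple 'I_n -> R) :
  (forall i J, 0 <= M i J) -> (forall i, 0 < M i [tuple of nseq m i]) ->
  continuous (fun v : 'rV[R]_n => log_potential p M (v ord0)).
Proof.
move=> M0 Md.
have scale (k : R) (f : 'rV[R]_n -> R) v :
    {for v, continuous f} -> {for v, continuous (fun x => k * f x)}.
  by move=> fv; apply: (@continuousM _ _ (fun=> k) f) => //;
    exact: cst_continuous.
apply: (@continuous_big _ _ _ 0) => [|i _ v]; first exact: add_continuous.
apply: (scale).
apply: (@continuous_comp _ _ _ (fun v : 'rV[R]_n => row_weight M (v ord0) i)).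
  move: v; apply: (@continuous_big _ _ _ 0) => [|J _ v].
    exact: add_continuous.
  apply: (scale).
  apply: (@continuous_comp _ _ _
    (fun v : 'rV[R]_n => \sum_(j <- J) (v ord0 j - v ord0 i))); last first.
    exact: continuous_expR.
  move: v; apply: (@continuous_big _ _ _ 0) => [|j _ v].
    exact: add_continuous.
  by apply: (@continuousB _ _ _ (fun v : 'rV[R]_n => v ord0 j)
    (fun v => v ord0 i)); exact: coord_continuous.
apply: continuous_ln; exact: lt_le_trans (ler_diag_row_weight _ _ M0).
Qed.

(** Each summand is at least its diagonal bound [p i * d i], so a bound on the total bounds every
    summand; the single term [M i J * rel_weight c i J] of the row weight then bounds the sum of
    [c j - c i]. *)
Lemma log_potential_spread (R : realType) (n m : nat) (p : 'I_n -> R)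
    (M : 'I_n -> m.-tuple 'I_n -> R) (B : R) :
  (0 < m)%N -> (forall i, 0 < p i) ->
  (forall i J, 0 <= M i J) -> (forall i, 0 < M i [tuple of nseq m i]) ->
  (forall I : {set 'I_n}, I != finset.set0 -> I \proper [set: 'I_n]%SET ->
    exists (i : 'I_n) (J : m.-tuple 'I_n),
      [/\ i \in I, forall j : 'I_n, j \in J -> j \notin I & 0 < M i J]) ->
  exists2 K, 0 <= K & forall c, log_potential p M c <= B ->
    forall i j, c i - c j <= K.
Proof.
move=> m0 p0 M0 Md irr.
pose d i := ln (M i [tuple of nseq m i]).
pose B' := B - \sum_i p i * d i.
(* Summing absolute values gives one nonnegative bound valid for all positive entries. *)
pose L := \sum_i \sum_(J : m.-tuple 'I_n) `|d i + B' / p i - ln (M i J)|.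
have L0 : 0 <= L by rewrite sumr_ge0 // => i _; rewrite sumr_ge0.
exists (n%:R * L) => [|c cB]; first by rewrite mulr_ge0.
have S0 i : 0 < row_weight M c i.
  exact: lt_le_trans (Md i) (ler_diag_row_weight _ _ M0).
have g0 i : 0 <= p i * (ln (row_weight M c i) - d i).
  rewrite mulr_ge0 ?(ltW (p0 i)) // subr_ge0 ler_ln ?posrE //.
  exact: ler_diag_row_weight.
have gB i : p i * (ln (row_weight M c i) - d i) <= B'.
  apply: (@le_trans _ _ (\sum_i p i * (ln (row_weight M c i) - d i))).
    by rewrite [leRHS](bigD1 i) //= lerDl sumr_ge0.
  under eq_bigr => l _ do rewrite mulrBr.
  by rewrite sumrB lerB.
apply: (irreducible_spread m0 L0 irr) => i J MJ.
apply: (@le_trans _ _ (d i + B' / p i - ln (M i J))); last first.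
  apply: le_trans (ler_norm _) _.
  rewrite /L (bigD1 i) //= (bigD1 J) //= -[leRHS]addrA lerDl.
  rewrite addr_ge0 ?sumr_ge0 //.
  by move=> l _; rewrite sumr_ge0.
have : ln (M i J * rel_weight c i J) <= ln (row_weight M c i).
  rewrite ler_ln ?posrE ?mulr_gt0 ?expR_gt0 //; exact: ler_row_weight.
rewrite lnM ?posrE ?expR_gt0 // /rel_weight expRK.
have : ln (row_weight M c i) - d i <= B' / p i.
  by rewrite ler_pdivlMr // mulrC.
lra.
Qed.

(** A competitor no worse than 0 can be translated to vanish at [ord0]; the spread bound then puts
    it in a compact box, so the minimiser over the box is global. *)
Lemma log_potential_min (R : realType) (n m : nat) (p : 'I_n -> R)
    (M : 'I_n -> m.-tuple 'I_n -> R) :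
  (0 < m)%N -> (forall i, 0 < p i) ->
  (forall i J, 0 <= M i J) -> (forall i, 0 < M i [tuple of nseq m i]) ->
  (forall I : {set 'I_n}, I != finset.set0 -> I \proper [set: 'I_n]%SET ->
    exists (i : 'I_n) (J : m.-tuple 'I_n),
      [/\ i \in I, forall j : 'I_n, j \in J -> j \notin I & 0 < M i J]) ->
  exists c, forall c', log_potential p M c <= log_potential p M c'.
Proof.
case: n p M => [|n] p M m0 p0 M0 Md irr.
  by exists (fun=> 0) => c'; rewrite /log_potential !big_ord0.
have [K K0 hK] := log_potential_spread (log_potential p M (fun=> 0))
  m0 p0 M0 Md irr.
pose F (v : 'rV[R]_n.+1) := log_potential p M (v ord0).
pose box : set 'rV[R]_n.+1 :=
  [set v | forall i, `[- K, K]%classic (v ord0 i)]%classic.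
have z : box 0 by move=> i /=; rewrite mxE in_itv /= oppr_le0 K0.
have [|||v _ vmin] := @compact_EVT_min _ _ F box.
- by exists 0.
- exact: (@rV_compact R _ (fun=> `[- K, K]%classic)
    (fun=> @segment_compact R _ _)).
- exact: (continuous_subspaceT (continuous_log_potential M0 Md)).
have Fz : F 0 = log_potential p M (fun=> 0).
  apply: eq_bigr => i _; congr (_ * ln _); apply: eq_bigr => J _.
  by congr (_ * expR _); apply: eq_bigr => j _; rewrite !mxE.
exists (v ord0) => c'.
have [h|h] := leP (log_potential p M c') (log_potential p M (fun=> 0)).
  pose v' : 'rV[R]_n.+1 := \row_i (c' i - c' ord0).
  have -> : log_potential p M c' = F v'.
    rewrite -(log_potential_shift p M c' (c' ord0)).
    apply: eq_bigr => i _; congr (_ * ln _); apply: eq_bigr => J _.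
    by congr (_ * expR _); apply: eq_bigr => j _; rewrite !mxE.
  apply: vmin; rewrite inE => i /=.
  by rewrite mxE in_itv /= lerNl opprB !hK.
by apply/ltW/(le_lt_trans _ h); rewrite -Fz; apply: vmin; rewrite inE.
Qed.

(** * Critical point equations *)

(** Puts a perturbation of one coordinate into the form that [expR_sum_stationary] treats; the
    correction by [m] at [i = l] arises because all [m] differences involve [c i]. *)
Lemma rel_weight_bump (R : realType) (n m : nat) (c : 'I_n -> R) (t : R)
    (l i : 'I_n) (J : m.-tuple 'I_n) :
  rel_weight (fun j => c j + t * (j == l)%:R) i J =
  rel_weight c i J *
    expR (t * ((count_mem l J)%:R - m%:R * (i == l)%:R)).
Proof.
rewrite /rel_weight -expRD; congr expR.
have -> : t * ((count_mem l J)%:R - m%:R * (i == l)%:R) =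
    \sum_(j <- J) t * ((j == l)%:R - (i == l)%:R).
  rewrite -mulr_sumr sumrB; congr (t * (_ - _)).
    by rewrite -sum1_count natr_sum [in RHS](bigID (pred1 l)) /=
      [X in _ = _ + X]big1 ?addr0 => [|j /negPf->//];
      apply: eq_bigr => j ->.
  by rewrite big_const_seq count_predT size_tuple iter_addr_0 mulr_natl.
by rewrite -big_split /=; apply: eq_bigr => j _; ring.
Qed.

(* The critical point equations of [log_potential], without derivatives:
   [ln x <= x - 1] bounds its increments by exponential sums. *)
Lemma scaling_exists (R : realType) (n m : nat) (p : 'I_n -> R)
    (M : 'I_n -> m.-tuple 'I_n -> R) :
  (0 < m)%N -> (forall i, 0 < p i) ->
  (forall i J, 0 <= M i J) -> (forall i, 0 < M i [tuple of nseq m i]) ->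
  (forall I : {set 'I_n}, I != finset.set0 -> I \proper [set: 'I_n]%SET ->
    exists (i : 'I_n) (J : m.-tuple 'I_n),
      [/\ i \in I, forall j : 'I_n, j \in J -> j \notin I & 0 < M i J]) ->
  exists a c : 'I_n -> R,
    let N i (J : m.-tuple 'I_n) := M i J * expR (a i + \sum_(j <- J) c j) in
    (forall i, \sum_J N i J = p i) /\
    (forall l, \sum_i \sum_J N i J * (count_mem l J)%:R = m%:R * p l).
Proof.
move=> m0 p0 M0 Md irr.
have [c cmin] := log_potential_min m0 p0 M0 Md irr.
have S0 c' i : 0 < row_weight M c' i.
  exact: lt_le_trans (Md i) (ler_diag_row_weight _ _ M0).
(* The logarithms rescale row [i] to total [p i]; subtracting [m c i] turns the sum of [c j] into
   that of [c j - c i]. *)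
exists (fun i => ln (p i) - ln (row_weight M c i) - m%:R * c i), c => N.
have NE i J : N i J = p i / row_weight M c i * (M i J * rel_weight c i J).
  rewrite /N mulrCA; congr (_ * _).
  rewrite /rel_weight sumrB big_const_seq count_predT size_tuple iter_addr_0.
  rewrite -{2}(lnK (p0 i)) -{2}(lnK (S0 c i)) -expRN -!expRD.
  by congr expR; rewrite mulr_natl; ring.
have Nrow i : \sum_J N i J = p i.
  under eq_bigr => J _ do rewrite NE.
  by rewrite -mulr_sumr mulfVK // gt_eqF.
split=> // l.
pose k (x : 'I_n * m.-tuple 'I_n) : R :=
  (count_mem l x.2)%:R - m%:R * (x.1 == l)%:R.
have : \sum_x N x.1 x.2 * k x = 0.
  apply: expR_sum_stationary => [x|t].
    by rewrite mulr_ge0 // expR_ge0.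
  pose c' j := c j + t * (j == l)%:R.
  have := cmin c'; rewrite -subr_ge0 => /le_trans; apply.
  rewrite /log_potential -sumrB -(pair_bigA _
    (fun i J => N i J * (expR (t * k (i, J)) - 1))) /=.
  apply: ler_sum => i _.
  (* As row [i] of [N] sums to [p i], the increment becomes a ratio of row weights, to which
     [ln r <= r - 1] applies. *)
  have -> : \sum_J N i J * (expR (t * k (i, J)) - 1) =
      p i * (row_weight M c' i / row_weight M c i - 1).
    under eq_bigr => J _ do rewrite mulrBr mulr1.
    rewrite sumrB Nrow mulrBr mulr1; congr (_ - _).
    rewrite mulrCA [RHS]mulrC [row_weight M c' i]/row_weight mulr_sumr.
    apply: eq_bigr => J _.
    by rewrite NE rel_weight_bump /k /=; ring.
  rewrite -mulrBr ler_pM2l // -ln_div ?posrE //.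
  have := @le_ln1Dx R (row_weight M c' i / row_weight M c i - 1).
  rewrite (addrC 1) subrK; apply.
  by rewrite -subr_gt0 opprK subrK divr_gt0.
rewrite -(pair_bigA _ (fun i J => N i J * k (i, J))) /= /k /=.
(* The subtracted part of [k] survives only at [i = l], where the row sum is [p l]. *)
under eq_bigr => i _.
  under eq_bigr => J _ do rewrite mulrBr.
  rewrite sumrB -mulr_suml Nrow; over.
rewrite sumrB => /eqP; rewrite subr_eq0 => /eqP->.
rewrite (bigD1 l) //= eqxx mulr1 big1 ?addr0 => [|i /negPf->].
  by rewrite mulrC.
by rewrite !mulr0.
Qed.

(** * Counting occurrences in symmetric sums *)

Lemma sum_tuple_cons (V : nmodType) (X : finType) (m : nat)
    (F : m.+1.-tuple X -> V) :
  \sum_J F J = \sum_x \sum_(K : m.-tuple X) F [tuple of x :: K].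
Proof.
rewrite pair_bigA /=.
rewrite (reindex (fun z : X * m.-tuple X => [tuple of z.1 :: z.2])) //=.
exists (fun J => (thead J, [tuple of behead J])) => [[x K] _ | J _] /=.
  by rewrite theadE; congr pair; apply: val_inj.
by apply: val_inj; rewrite /= [in RHS](tuple_eta J).
Qed.

(* A transposition of positions moves any occurrence of [l] to the head. *)
Lemma sum_symmetric_count (R : comNzRingType) (X : finType) (m : nat)
    (F : m.+1.-tuple X -> R) (l : X) :
  (forall J K : m.+1.-tuple X, perm_eq J K -> F J = F K) ->
  \sum_J F J * (count_mem l J)%:R =
  m.+1%:R * \sum_(K : m.-tuple X) F [tuple of l :: K].
Proof.
move=> sym.
have head : \sum_J F J * (tnth J ord0 == l)%:R =
    \sum_(K : m.-tuple X) F [tuple of l :: K].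
  rewrite sum_tuple_cons (bigD1 l) //= [X in _ + X]big1 ?addr0.
    by apply: eq_bigr => K _; rewrite tnth0 eqxx mulr1.
  move=> j /negPf jl; rewrite big1 // => K _.
  by rewrite tnth0 jl mulr0.
(* The count is a sum of indicators over the [m.+1] positions, each contributing as much as the
   head. *)
under eq_bigr => J _.
  have -> : (count_mem l J)%:R = \sum_(s < m.+1) (tnth J s == l)%:R :> R.
    by rewrite -sum1_count big_tuple natr_sum big_mkcond /=;
      apply: eq_bigr => s _; case: eqP.
  rewrite mulr_sumr; over.
rewrite exchange_big /= -head.
under eq_bigr => s _.
  have -> : \sum_J F J * (tnth J s == l)%:R =
      \sum_J F J * (tnth J ord0 == l)%:R.
    pose h (J : m.+1.-tuple X) : m.+1.-tuple X :=
      [tuple tnth J (tperm ord0 s i) | i < m.+1].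
    have hh : involutive h.
      by move=> J; apply: eq_from_tnth => i; rewrite !tnth_mktuple tpermK.
    rewrite (reindex_inj (inv_inj hh)); apply: eq_bigr => J _.
    rewrite tnth_mktuple tpermR; congr (_ * _); apply: sym.
    by apply/tuple_permP; exists (tperm ord0 s).
  over.
by rewrite sumr_const card_ord mulr_natl.
Qed.

(** * Spectral radius from a positive fixed vector *)

(** The condition [f 0 = 0] handles the default value of [entry] on sequences of wrong length. *)
Lemma entry_tensor_map (R S : nmodType) (n d : nat) (f : R -> S)
    (T : tensor R n d) (s : seq 'I_n) :
  f 0 = 0 -> entry (tensor_map f T) s = f (entry T s).
Proof. by move=> f0; rewrite /entry; case: insub => //= I; rewrite ffunE. Qed.

Lemma tensor_app_real_complex (R : rcfType) (n d : nat) (T : tensor R n d)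
    (u : 'cV[R]_n) :
  tensor_app (tensor_map (real_complex R) T) (map_mx (real_complex R) u) =
  map_mx (real_complex R) (tensor_app T u).
Proof.
apply/matrixP => i z; rewrite !mxE rmorph_sum; apply: eq_bigr => J _.
rewrite entry_tensor_map ?rmorph0 // rmorphM rmorph_prod.
by congr (_ * _); apply: eq_bigr => j _; rewrite mxE.
Qed.

(* The eigenvector [x] is compared with [u] at an index maximising
   [`|x i| / u i]. *)
Lemma spectral_radius_positive_fixpoint (R : rcfType) (n d : nat)
    (T : tensor R n d) (u : 'cV[R]_n) :
  (0 < n)%N -> (forall i (J : d.-1.-tuple 'I_n), 0 <= entry T (i :: J)) ->
  (forall i, 0 < u i 0) -> tensor_app T u = vec_pow u d.-1 ->
  is_spectral_radius T 1.
Proof.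
move=> n0 T0 u0 Tu; split.
  exists 1; split; last by rewrite normr1.
  exists (map_mx (real_complex R) u); split.
    apply/eqP => /matrixP /(_ (Ordinal n0) 0); rewrite !mxE.
    by move/eqP; rewrite (fmorph_eq0 (real_complex R)) gt_eqF.
  rewrite tensor_app_real_complex Tu scale1r.
  by apply/matrixP => i z; rewrite !mxE rmorphXn.
move=> lam [x [x0 Tx]].
have normE (z : R[i]) : `|z| = (complex.Re `|z|)%:C.
  by case: z => a b; rewrite normc_def.
pose q i := complex.Re `|x i 0| / u i 0.
pose i := [arg max_(i > Ordinal n0) q i]%O.
have qmax j : q j <= q i.
  by rewrite /i; case: arg_maxP => // l _; apply.
have xq j : `|x j 0| <= (q i * u j 0)%:C.
  by rewrite normE lecR -ler_pdivrMr // qmax.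
have xi : `|x i 0| = (q i * u i 0)%:C.
  by rewrite normE /q divfK ?gt_eqF.
have q0 : 0 < q i.
  (* A nonzero coordinate has modulus at most [q i * u j 0] by [xq], which forces [q i] to be
     positive. *)
  have [j xj] : exists j, x j 0 != 0.
    apply/existsP; apply: contraNT x0; rewrite negb_exists => /forallP H.
    by apply/eqP/matrixP => j z; rewrite ord1 mxE; apply/eqP/negPn.
  have : 0 < (q i * u j 0)%:C by apply: lt_le_trans (xq j); rewrite normr_gt0.
  by rewrite ltcR pmulr_lgt0.
(* Since [lam x_i^(d-1) = T(x)_i], the triangle inequality and [|x_j| <= q_i u_j] bound the left
   side by [q_i^(d-1) T(u)_i = |x_i|^(d-1)]. *)
have : `|lam| * `|x i 0| ^+ d.-1 <= `|x i 0| ^+ d.-1.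
  rewrite -normrX -normrM.
  have -> : lam * x i 0 ^+ d.-1 = (lam *: vec_pow x d.-1) i 0 by rewrite !mxE.
  rewrite -Tx mxE; apply: le_trans (ler_norm_sum _ _ _) _.
  have := congr1 (fun y : 'cV_n => y i 0) Tu; rewrite !mxE => Tui.
  rewrite normrX xi -rmorphXn exprMn -Tui mulr_sumr rmorph_sum.
  apply: ler_sum => J _; rewrite entry_tensor_map ?rmorph0 // normrM.
  have TC : 0 <= (entry T (i :: J))%:C by rewrite lecR.
  rewrite mulrCA rmorphM (ger0_norm TC); apply: ler_wpM2l => //.
  rewrite normr_prod.
  have -> : q i ^+ d.-1 * \prod_(j <- J) u j 0 = \prod_(j <- J) (q i * u j 0).
    by rewrite big_split /= big_const_seq count_predT size_tuple iter_mulr_1.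
  rewrite rmorph_prod; elim: (tval J) => [|j r IH]; first by rewrite !big_nil.
  by rewrite !big_cons ler_pM // prodr_ge0.
rewrite -[leRHS]mul1r ler_pM2r //.
by rewrite exprn_gt0 // xi ltcR mulr_gt0.
Qed.

(** * Construction of the tensor and its eigenvector equations *)

(** Makes the left factor of [A] explicit: a right inverse of a square matrix is its inverse. *)
Lemma invmx_diag_exp (F : fieldType) (n p : nat) (u : 'cV[F]_n) :
  (forall i, u i 0 != 0) ->
  invmx (diag_mx u^T ^+ p) = diag_mx (\row_i (u i 0 ^- p)).
Proof.
move=> u0.
have -> : diag_mx u^T ^+ p = diag_mx (\row_i u i 0 ^+ p).
  elim: p => [|p IH].
    by apply/matrixP => i j; rewrite expr0 !mxE expr0.
  rewrite exprS IH -mulmxE mulmx_diag.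
  by congr diag_mx; apply/rowP => i; rewrite !mxE exprS.
set X := diag_mx _; set Y := diag_mx _.
have XY : X *m Y = 1%:M.
  rewrite mulmx_diag; apply/matrixP => i j; rewrite !mxE mulfV //.
  by rewrite expf_neq0.
by have [Xu _] := mulmx1_unit XY; rewrite -[LHS]mulmx1 -XY mulKmx.
Qed.

Theorem theorem14 (R : realType) (n d : nat) (hn : (1 <= n)%N) (hd : (3 <= d)%N)
    (T' : tensor R n d) (hT' : ps_nonneg T') (hirr : tensor_irreducible T')
    (hdiag : forall i : 'I_n, 0 < T' [tuple of nseq d i])
    (u w : 'cV[R]_n)
    (hu : forall i : 'I_n, 0 < u i 0) (hw : forall i : 'I_n, 0 < w i 0)
    (huw : \sum_(i < n) u i 0 * w i 0 = 1) :
  exists T : tensor R n d,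
    [/\ ps_nonneg T,
        diag_equivalent T T',
        tensor_app T u = vec_pow u d.-1,
        is_spectral_radius T 1
      & let A : 'M[R]_n := invmx (diag_mx u^T ^+ d.-2) *m tensor_D T u in
        [/\ A *m u = d.-1%:R *: u,
            A^T *m w = d.-1%:R *: w
          & w^T *m u = 1%:M]].
Proof.
case: d hd T' hT' hirr hdiag => [|[|[|k]]] // _ T' [T'0 T'sym] irr T'd.
pose uP (J : seq 'I_n) : R := \prod_(j <- J) u j 0.
have uP0 J : 0 < uP J.
  by rewrite /uP; elim: J => [|j J IH]; rewrite ?big_nil // big_cons mulr_gt0.
(* Chosen so that [u_i^(d-1) g_i = u_i w_i]: row sums [u_i w_i] then mean [T(u)_i = u_i^(d-1)]. Here
   [d = k + 3], so [k.+1] is [d - 2]. *)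
pose g i := w i 0 / u i 0 ^+ k.+1.
have g0 i : 0 < g i by rewrite divr_gt0 ?exprn_gt0.
pose M i (J : k.+2.-tuple 'I_n) := entry T' (i :: J) * (uP J * g i).
have T'e i (J : k.+2.-tuple 'I_n) : entry T' (i :: J) = T' [tuple of i :: J].
  by rewrite -entryE.
have [||i J|i|I I0 IT|a [c [rowN colN]]] :=
    @scaling_exists R n k.+2 (fun i => u i 0 * w i 0) M.
- by [].
- by move=> i; rewrite mulr_gt0.
- by rewrite mulr_ge0 ?T'e // ltW // mulr_gt0.
- rewrite /M; apply: mulr_gt0; last exact: mulr_gt0.
  by rewrite T'e (_ : [tuple of _] = [tuple of nseq k.+3 i]) //; apply: val_inj.
- have [i [J [iI JI T'J]]] := irr I I0 IT; exists i, J; split => //.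
  by rewrite /M; apply: mulr_gt0 => //; exact: mulr_gt0.
pose T : tensor R n k.+3 :=
  [ffun L => T' L * expR (a (thead L) + \sum_(j <- behead L) c j)].
have TE i (J : k.+2.-tuple 'I_n) :
    entry T (i :: J) = entry T' (i :: J) * expR (a i + \sum_(j <- J) c j).
  by rewrite T'e (entryE T [tuple of i :: J]) ffunE theadE.
have T0 i (J : k.+2.-tuple 'I_n) : 0 <= entry T (i :: J).
  by rewrite TE mulr_ge0 ?expR_ge0 // T'e.
have Tsym i (J K : k.+2.-tuple 'I_n) :
    perm_eq J K -> entry T (i :: J) = entry T (i :: K).
  by move=> JK; rewrite !TE (T'sym _ _ _ JK) (perm_big _ JK).
pose N i (J : k.+2.-tuple 'I_n) := entry T (i :: J) * (uP J * g i).
have NE i J : M i J * expR (a i + \sum_(j <- J) c j) = N i J.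
  by rewrite /N TE /M; ring.
have Tu i : \sum_(J : k.+2.-tuple 'I_n) entry T (i :: J) * uP J
    = u i 0 ^+ k.+2.
  apply: (mulIf (lt0r_neq0 (g0 i))); rewrite mulr_suml.
  transitivity (\sum_J M i J * expR (a i + \sum_(j <- J) c j)).
    by apply: eq_bigr => J _; rewrite NE /N mulrA.
  rewrite rowN /g exprS -mulrA; congr (_ * _).
  by rewrite mulrCA mulfV ?mulr1 // expf_neq0 // lt0r_neq0.
(* Symmetry in the last indices turns the count in [colN] into [d - 1] times the sum over tuples
   with head [j]; then [(d - 1) u_j] cancels. *)
have Tw j :
    \sum_i g i * \sum_(K : k.+1.-tuple 'I_n) entry T (i :: j :: K) * uP K =
    w j 0.
  apply: (mulfI (lt0r_neq0 (hu j))).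
  have k0 : k.+2%:R != 0 :> R by rewrite pnatr_eq0.
  apply: (mulfI k0); rewrite -colN 2!mulr_sumr; apply: eq_bigr => i _.
  under [RHS]eq_bigr => J _ do rewrite NE.
  rewrite sum_symmetric_count => [|J K JK].
    rewrite !mulr_sumr; apply: eq_bigr => K _.
    by rewrite /N /uP /= big_cons; ring.
  by rewrite /N (Tsym _ _ _ JK) /uP (perm_big _ JK).
exists T; split.
- by split => // L; rewrite ffunE mulr_ge0 ?expR_ge0.
(* The equivalence is oriented from [T] to [T'], hence the signs. *)
- exists (\col_i - a i), (\col_i - c i) => i J.
  rewrite TE -mulrA -expRD mxE.
  under [X in _ + (_ + X)]eq_bigr => j _ do rewrite mxE.
  by rewrite sumrN -opprD subrr expR0 mulr1.
- by apply/matrixP => i z; rewrite ord1 !mxE Tu.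
- apply: (@spectral_radius_positive_fixpoint R n k.+3 T u hn T0 hu).
  by apply/matrixP => i z; rewrite ord1 !mxE Tu.
have AE i j : (invmx (diag_mx u^T ^+ k.+1) *m tensor_D T u) i j =
    u i 0 ^- k.+1 *
    (k.+2%:R * \sum_(K : k.+1.-tuple 'I_n) entry T (i :: j :: K) * uP K).
  rewrite invmx_diag_exp => [|l]; last exact: lt0r_neq0.
  by rewrite mul_diag_mx !mxE.
move=> A; split; apply/matrixP => i z; rewrite ord1 !mxE.
- under eq_bigr => j _ do rewrite AE -2!mulrA mulr_suml.
  rewrite -2!mulr_sumr.
  (* Joining [j] and [K] into one tuple recovers [T(u)_i]. *)
  have -> : \sum_j \sum_(K : k.+1.-tuple 'I_n)
      entry T (i :: j :: K) * uP K * u j 0 = u i 0 ^+ k.+2.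
    rewrite -Tu sum_tuple_cons; apply: eq_bigr => j _; apply: eq_bigr => K _.
    by rewrite /uP big_cons -mulrA [in RHS](mulrC (u j 0)).
  by rewrite (exprSr _ k.+1) mulrCA mulKf // expf_neq0 // lt0r_neq0.
(* The product of [w_j] and [u_j^-(d-2)] is [g j], so this is [Tw] multiplied by [d - 1]. *)
- rewrite -(Tw i) mulr_sumr; apply: eq_bigr => j _.
  by rewrite mxE AE /g /=; ring.
- by rewrite (ord1 z) eqxx -huw; apply: eq_bigr => j _; rewrite mxE mulrC.
Qed.
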